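(* Assume $\phi\in H^1_{\mathrm{per}}(0,1)$ with $\|\phi'\|_{L^2(0,1)}>0$, $b>1$, $0<a<1<ab$, and $\kappa\in\mathbb R$, $\kappa\ne0$. Let $V:(0,\infty)\to\mathbb R$ be differentiable, let $W_N(x)=\sum_{n=0}^Na^n\phi(b^nx)$, $U_N=V+\kappa W_N$, and for $h>0$ let $$\mathcal K_{N,h}^{\mathrm{cl}}(x,p)=\left(x,\;p-\frac h2U_N'(x)\right),\qquad U_N'(x)=V'(x)+\kappa W_N'(x).$$ Let $\gamma$ be any probability measure on $\mathbb R$, equip $(0,1)\times\mathbb R$ with the measure $dx\otimes\gamma(dp)$, and let $$\zeta_N=\left[\frac1{b^N}\int_0^{b^N}|\phi'(u)|^2\,du\right]^{1/2}.$$ Then for every sequence of step sizes $h_N>0$ and every $N\ge1$, $$\bigl\|\mathcal K_{N,h_N}^{\mathrm{cl}}-\mathcal K_{N-1,h_N}^{\mathrm{cl}}\bigr\|_{L^2(dx\otimes\gamma)}=\frac{|\kappa|h_N}2\,(ab)^N\zeta_N .$$ Consequently: (i) for every fixed $h>0$, the sequence of classical kick maps $\{\mathcal K_{N,h}^{\mathrm{cl}}\}_{N\ge0}$ is not Cauchy in $L^2(dx\otimes\gamma)$; (ii) a necessary condition for adjacent-resolution consistency, i.e. for $\|\mathcal K_{N,h_N}^{\mathrm{cl}}-\mathcal K_{N-1,h_N}^{\mathrm{cl}}\|_{L^2(dx\otimes\gamma)}\to0$, is $$h_N(ab)^N\longrightarrow0 .$$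
   Context: $H^1_{\mathrm{per}}(0,1)$ denotes the one-periodic functions on $\mathbb R$ that are locally in $H^1$, and $W_N'(x)=\sum_{n=0}^N(ab)^n\phi'(b^nx)$ is the weak derivative. The $L^2(dx\otimes\gamma)$ norm of an $\mathbb R^2$-valued map $F$ on $(0,1)\times\mathbb R$ is $\left(\int_0^1\int_{\mathbb R}|F(x,p)|^2\,\gamma(dp)\,dx\right)^{1/2}$ with $|\cdot|$ Euclidean; ''not Cauchy'' refers to the $L^2$ distances (norms of differences) between the maps. *)

(* Defs.v *)
From HB Require Import structures.
From mathcomp Require Import all_boot all_order all_algebra.
From mathcomp Require Import all_classical all_reals all_analysis.
From mathcomp Require Import measurable_realfun.
Set Implicit Arguments.
Unset Strict Implicit.
Unset Printing Implicit Defensive.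
Import Order.TTheory GRing.Theory Num.Theory.
Import numFieldNormedType.Exports.
Local Open Scope classical_set_scope.
Local Open Scope ring_scope.

Definition test_function (R : realType) (psi : R -> R) : Prop :=
  (forall n x, derivable (derive1n n psi) x 1) /\
  compact (closure [set x | psi x != 0]).

Definition weak_derivative (R : realType) (f g : R -> R) : Prop :=
  [/\ locally_integrable setT f, locally_integrable setT g &
    forall psi : R -> R, test_function psi ->
      \int[lebesgue_measure]_x (f x * derive1 psi x) =
      - \int[lebesgue_measure]_x (g x * psi x)].

Definition L2loc (R : realType) (f : R -> R) : Prop :=
  measurable_fun setT f /\ locally_integrable setT (fun x => f x ^+ 2).

Definition H1loc (R : realType) (f : R -> R) : Prop :=
  L2loc f /\ exists2 g : R -> R, weak_derivative f g & L2loc g.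

Definition H1per (R : realType) (f : R -> R) : Prop :=
  periodic f 1 /\ H1loc f.

Definition weierstrass (R : realType) (a b : R) (phi : R -> R) (N : nat)
    (x : R) : R :=
  \sum_(0 <= n < N.+1) a ^+ n * phi (b ^+ n * x).

(* The weak derivative of [weierstrass a b phi N] when [dphi] is a weak
   derivative of [phi]; see [weak_derivative_weierstrass] below. *)
Definition dweierstrass (R : realType) (a b : R) (dphi : R -> R) (N : nat)
    (x : R) : R :=
  \sum_(0 <= n < N.+1) (a * b) ^+ n * dphi (b ^+ n * x).

(* U_N' = V' + kappa W_N', where U_N = V + kappa W_N. *)
Definition dpotential (R : realType) (V : R -> R) (kappa a b : R)
    (dphi : R -> R) (N : nat) (x : R) : R :=
  derive1 V x + kappa * dweierstrass a b dphi N x.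

Definition kick_cl (R : realType) (V : R -> R) (kappa a b : R)
    (dphi : R -> R) (N : nat) (h : R) (z : R * R) : R * R :=
  (z.1, z.2 - h / 2 * dpotential V kappa a b dphi N z.1).

(* The library norm on [R * R] is the sup norm, hence the explicit Euclidean
   one. *)
Definition euclid (R : realType) (v : R * R) : R :=
  Num.sqrt (v.1 ^+ 2 + v.2 ^+ 2).

(* The L^2(dx (x) gamma) norm on (0,1) x R, valued in the extended reals. *)
Definition L2norm (R : realType) (gamma : probability (measurableTypeR R) R)
    (F : R * R -> R * R) : \bar R :=
  ((\int[lebesgue_measure]_(x in `]0%R, 1%R[)
      \int[gamma]_p (euclid (F (x, p)) ^+ 2)%:E) `^ 2^-1)%E.

Definition L2cauchy (R : realType) (gamma : probability (measurableTypeR R) R)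
    (F : nat -> R * R -> R * R) : Prop :=
  forall e : R, 0 < e -> exists M : nat, forall m n : nat,
    (M <= m)%N -> (M <= n)%N -> (L2norm gamma (F m \- F n)%R < e%:E)%E.

Definition L2norm01 (R : realType) (f : R -> R) : \bar R :=
  ((\int[lebesgue_measure]_(x in `]0%R, 1%R[) (`|f x| ^+ 2)%:E) `^ 2^-1)%E.

Definition zeta (R : realType) (b : R) (dphi : R -> R) (N : nat) : R :=
  Num.sqrt ((b ^+ N)^-1 *
    \int[lebesgue_measure]_(u in `]0, (b ^+ N)[) (`|dphi u| ^+ 2)).

Lemma lebesgue_measure_scale (R : realType) (c : R) (c0 : 0 < c)
    (A : set R) : measurable A ->
  lebesgue_measure A =
  (c%:E * lebesgue_measure ((fun x => (c * x)%R) @^-1` A))%E.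
Proof.
move=> mA.
have mc : measurable_fun setT
    ((fun x => c * x) : measurableTypeR R -> measurableTypeR R).
  exact: measurable_funM.
pose g := (fun x => c * x) : measurableTypeR R -> measurableTypeR R.
pose m := mscale (NngNum (ltW c0)) (pushforward (@lebesgue_measure R) g).
rewrite (@lebesgue_measure_unique R (m mc) _ A)// => _ [[u v]] _ <-.
change (lebesgue_measure `]u, v] =
  c%:E * lebesgue_measure (g @^-1` `]u, v]))%E.
rewrite (_ : g @^-1` _ = `]u / c, v / c]%classic); last first.
  apply/seteqP; split => x /=; rewrite !in_itv/= => /andP[ux xv]; apply/andP; split.
  - by rewrite ltr_pdivrMr// mulrC.
  - by rewrite ler_pdivlMr// mulrC.
  - by move: ux; rewrite ltr_pdivrMr// mulrC.
  - by move: xv; rewrite ler_pdivlMr// mulrC.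
rewrite !lebesgue_measure_itv/= !lte_fin ltr_pM2r ?invr_gt0//.
case: ifPn => _; last by rewrite mule0.
by rewrite -!EFinD -EFinM -mulrBl mulrC divfK// gt_eqF.
Qed.

Lemma ge0_integral_scale (R : realType) (c : R) (c0 : 0 < c)
    (f : R -> \bar R) : measurable_fun setT f -> (forall x, 0 <= f x)%E ->
  (\int[lebesgue_measure]_x f x =
   c%:E * \int[lebesgue_measure]_x f (c * x)%R)%E.
Proof.
move=> mf f0.
have mc : measurable_fun setT
    ((fun x => c * x) : measurableTypeR R -> measurableTypeR R).
  exact: measurable_funM.
pose g := (fun x => c * x) : measurableTypeR R -> measurableTypeR R.
transitivity (c%:E * \int[pushforward (@lebesgue_measure R) g]_y f y)%E; last first.
  by rewrite (@ge0_integral_pushforward _ _ _ _ _ g)// preimage_setT.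
rewrite -[c]/((NngNum (ltW c0))%:num) -ge0_integral_mscale//.
apply: eq_measure_integral => A mA _.
exact: (lebesgue_measure_scale c0 mA).
Qed.

Lemma Rintegral_scale (R : realType) (c : R) (c0 : 0 < c) (f : R -> R) :
  lebesgue_measure.-integrable setT (EFin \o f) ->
  \int[lebesgue_measure]_x f x = c * \int[lebesgue_measure]_x f (c * x).
Proof.
move=> intf.
have mf := measurable_int _ intf.
rewrite /Rintegral integralE [in RHS]integralE.
have h g : measurable_fun setT g -> (forall x, 0 <= g x)%E ->
    (\int[lebesgue_measure]_x g x)%E \is a fin_num ->
    (\int[lebesgue_measure]_x g (c * x)%R)%E \is a fin_num.
  move=> mg g0; rewrite (ge0_integral_scale c0)//.
  rewrite !ge0_fin_numE ?mule_ge0 ?lee_fin ?(ltW c0) ?integral_ge0// => gy.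
  rewrite ltey; apply/eqP => gE; move: gy; rewrite gE gt0_muley ?lte_fin//.
rewrite (ge0_integral_scale c0)//; last exact: measurable_funepos.
rewrite [X in (_ - X)%E](ge0_integral_scale c0)//; last exact: measurable_funeneg.
have hp := h _ (measurable_funepos mf) (funepos_ge0 _)
  (integrable_pos_fin_num measurableT intf).
have hn := h _ (measurable_funeneg mf) (funeneg_ge0 _)
  (integrable_neg_fin_num measurableT intf).
rewrite -muleBr//; last by rewrite fin_num_adde_defl// fin_numN.
rewrite fineM//; last by rewrite fin_numB; apply/andP; split.
congr (_ * fine (_ - _)%E); apply: eq_integral => x _.
  by rewrite !funeposE.
by rewrite !funenegE.
Qed.

Lemma integrable_test (R : realType) (f psi : R -> R) :
  locally_integrable setT f -> continuous psi ->
  compact (closure [set x | psi x != 0]) ->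
  lebesgue_measure.-integrable setT (EFin \o (fun x => f x * psi x)).
Proof.
move=> [mf _ fK] cpsi; set K := closure _ => cK.
have mK : measurable K by exact: compact_measurable.
have [M [_ /(_ (M + 1))]] := compact_bounded (continuous_compact
  (continuous_subspaceT cpsi) cK).
rewrite ltrDl ltr01 => /(_ isT) /= hM.
have mpsi : measurable_fun setT psi.
  exact: continuous_measurable_fun.
rewrite (_ : EFin \o _ = (EFin \o (fun x => f x * psi x)) \_ K); last first.
  apply/funext => x; rewrite patchE; case: ifPn => //= xK.
  have [->|p0] := eqVneq (psi x) 0; first by rewrite mulr0.
  by case/negP: xK; rewrite inE; apply: subset_closure.
apply: (iffLR (@integrable_mkcond _ _ _ lebesgue_measure K
  (EFin \o (fun x => f x * psi x)) mK)).
apply: (@le_integrable _ (measurableTypeR R) R lebesgue_measure K mK _ (fun x => ((M + 1)%:E * (f x)%:E)%E)).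
- apply/measurable_EFinP; apply: measurable_funTS.
  exact: measurable_funM.
- move=> x Kx; rewrite /= lee_fin !normrM mulrC ler_wpM2r//.
  by rewrite (le_trans _ (ler_norm _))//; apply: hM; exists x.
apply: integrableZl => //; apply/integrableP; split.
  by apply/measurable_EFinP; exact: measurable_funTS.
exact: fK.
Qed.

Lemma test_continuous (R : realType) (psi : R -> R) :
  test_function psi -> continuous psi /\ continuous (derive1 psi).
Proof.
move=> [dpsi _]; split => x; apply/differentiable_continuous/derivable1_diffP.
  exact: (dpsi 0%N).
exact: (dpsi 1%N).
Qed.

Lemma test_derive_compact (R : realType) (psi : R -> R) :
  test_function psi -> compact (closure [set x | derive1 psi x != 0]).
Proof.
move=> [dpsi cK]; apply: (subclosed_compact _ cK); first exact: closed_closure.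
rewrite [X in _ `<=` X](closure_id _).1; last exact: closed_closure.
apply: closureS => x /= dx; apply: contrapT => nx; case/negP: dx.
have : nbhs x (~` closure [set y | psi y != 0]).
  by apply: open_nbhs_nbhs; split => //; apply: closed_openC; exact: closed_closure.
move=> nb; rewrite derive1E (@near_eq_derive _ _ _ psi (cst 0))//.
  by rewrite derive_cst.
near=> y.
have : (~` closure [set y | psi y != 0]) y by near: y.
move=> /= ny; apply/eqP; apply: contrapT => py; apply: ny.
by apply: subset_closure => /=; apply/negP => /eqP p; apply: py; rewrite p.
Unshelve. all: by end_near. Qed.

Lemma weak_derivativeD (R : realType) (f1 g1 f2 g2 : R -> R) :
  weak_derivative f1 g1 -> weak_derivative f2 g2 ->
  weak_derivative (fun x => f1 x + f2 x) (fun x => g1 x + g2 x).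
Proof.
move=> [f1i g1i h1] [f2i g2i h2]; split.
- exact: locally_integrableD.
- exact: locally_integrableD.
move=> psi tpsi; have [cp cdp] := test_continuous tpsi.
have [_ K] := tpsi; have dK := test_derive_compact tpsi.
under eq_Rintegral do rewrite mulrDl.
rewrite RintegralD//; [|exact: integrable_test..].
under [in RHS]eq_Rintegral do rewrite mulrDl.
rewrite [in RHS]RintegralD//; [|exact: integrable_test..].
by rewrite h1// h2// opprD.
Qed.

Lemma locally_integrableZ (R : realType) (k : R) (f : R -> R) :
  locally_integrable setT f -> locally_integrable setT (fun x => k * f x).
Proof.
move=> [mf oT fK]; split => //; first exact: measurable_funM.
move=> K KT cK.
have mK := compact_measurable cK.
under eq_integral do rewrite normrM EFinM.
rewrite ge0_integralZl//; last first.
  apply/measurable_EFinP; apply: measurableT_comp => //.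
  exact: measurable_funTS.
by rewrite lte_mul_pinfty// fK.
Qed.

Lemma weak_derivativeZ (R : realType) (k : R) (f g : R -> R) :
  weak_derivative f g ->
  weak_derivative (fun x => k * f x) (fun x => k * g x).
Proof.
move=> [fi gi h]; split; [exact: locally_integrableZ..|].
move=> psi tpsi; have [cp cdp] := test_continuous tpsi.
have [_ K] := tpsi; have dK := test_derive_compact tpsi.
under eq_Rintegral do rewrite -mulrA.
rewrite RintegralZl//; last exact: integrable_test.
under [in RHS]eq_Rintegral do rewrite -mulrA.
rewrite [in RHS]RintegralZl//; last exact: integrable_test.
by rewrite h// mulrN.
Qed.

Lemma locally_integrable_scale (R : realType) (c : R) (c0 : 0 < c)
    (f : R -> R) :
  locally_integrable setT f -> locally_integrable setT (fun x => f (c * x)).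
Proof.
move=> [mf oT fK]; split => //.
  by apply: (measurableT_comp mf); exact: measurable_funM.
move=> K KT cK.
have cK' : compact [set c * x | x in K].
  by apply: continuous_compact => //; apply: continuous_subspaceT;
    exact: mulrl_continuous.
have mK' := compact_measurable cK'.
have := fK _ (@subsetT _ _) cK'.
rewrite integral_mkcond (ge0_integral_scale c0); last 2 first.
- apply: (iffLR (measurable_restrictT _ mK')); apply: measurable_funTS.
  by apply/measurable_EFinP; exact: measurableT_comp.
- by move=> x; apply: erestrict_ge0.
rewrite [X in _ -> (X < _)%E]integral_mkcond.
have E x : (c * x \in [set c * x | x in K]) = (x \in K).
  apply/idP/idP; rewrite !inE /=; last by exists x.
  by move=> [y Ky /(mulfI (lt0r_neq0 c0)) <-].
rewrite [X in (_ * X)%E](_ : _ = \int[lebesgue_measure]_x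
    (((fun x => `|f (c * x)|%:E) \_ K) x))%E; last first.
  by apply: eq_integral => x _; rewrite !patchE E.
set I := (\int[_]_x _)%E => cI; rewrite ltey; apply/eqP => Iy.
by move: cI; rewrite Iy gt0_muley ?lte_fin.
Qed.

Lemma derive1n_scale (R : realType) (c : R) (psi : R -> R) :
  (forall n x, derivable (derive1n n psi) x 1) ->
  forall n, derive1n n (fun x => psi (c * x)) =
    (fun x => c ^+ n * derive1n n psi (c * x)).
Proof.
move=> d; elim=> [|n IH]; first by apply/funext => x; rewrite /= expr0 mul1r.
rewrite derive1nS IH; apply/funext => x.
have dc : derivable (fun x => c * x) x 1 by apply: derivableM.
have dd : derivable (derive1n n psi \o (fun x => c * x)) x 1.
  apply/derivable1_diffP; apply: differentiable_comp; apply/derivable1_diffP => //.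
rewrite (derive1Ml _ dd) (derive1_comp dc (d _ _)) derive1Ml// derive1_id mulr1.
by rewrite exprSr -mulrA; congr (_ * _); rewrite mulrC.
Qed.

Lemma test_scale (R : realType) (c : R) (c0 : 0 < c) (psi : R -> R) :
  test_function psi -> test_function (fun x => psi (c * x)).
Proof.
move=> [d K]; split.
  move=> n x; rewrite (derive1n_scale _ d).
  apply: derivableM => //.
  apply/derivable1_diffP; apply: differentiable_comp; apply/derivable1_diffP => //.
have cK' : compact [set c^-1 * x | x in closure [set x | psi x != 0]].
  by apply: continuous_compact => //; apply: continuous_subspaceT;
    exact: mulrl_continuous.
apply: (subclosed_compact _ cK'); first exact: closed_closure.
rewrite [X in _ `<=` X](closure_id _).1; last exact: compact_closed.
apply: closureS => x /= px; exists (c * x).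
  exact: subset_closure.
by rewrite mulKf// lt0r_neq0.
Qed.

Lemma weak_derivative_scale (R : realType) (c : R) (c0 : 0 < c)
    (f g : R -> R) :
  weak_derivative f g ->
  weak_derivative (fun x => f (c * x)) (fun x => c * g (c * x)).
Proof.
move=> [fi gi h]; split.
- exact: locally_integrable_scale.
- exact/locally_integrableZ/locally_integrable_scale.
move=> psi tpsi.
have ci0 : 0 < c^-1 by rewrite invr_gt0.
have tpsi' := test_scale ci0 tpsi.
have [cp cdp] := test_continuous tpsi'.
have [_ K] := tpsi'; have dK := test_derive_compact tpsi'.
have := h _ tpsi'.
rewrite (Rintegral_scale c0); last exact: integrable_test.
rewrite [in RHS](Rintegral_scale c0); last exact: integrable_test.
rewrite -mulrN => /(mulfI (lt0r_neq0 c0)).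
have D := derive1n_scale c^-1 (tpsi.1) 1; rewrite !derive1n1 in D.
rewrite D.
under eq_Rintegral do rewrite mulKf ?lt0r_neq0// expr1 mulrCA.
under [in RHS]eq_Rintegral do rewrite mulKf ?lt0r_neq0//.
have [cp0 cdp0] := test_continuous tpsi.
have [_ K0] := tpsi; have dK0 := test_derive_compact tpsi.
rewrite RintegralZl//; last first.
  by apply: integrable_test => //; exact: locally_integrable_scale.
move=> e.
under [in RHS]eq_Rintegral do rewrite -mulrA.
rewrite [in RHS]RintegralZl//; last first.
  by apply: integrable_test => //; exact: locally_integrable_scale.
by rewrite -mulrN -e mulVKf// lt0r_neq0.
Qed.

Lemma weak_derivative_weierstrass (R : realType) (a b : R) (phi dphi : R -> R)
    (N : nat) : 0 < b -> weak_derivative phi dphi ->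
  weak_derivative (weierstrass a b phi N) (dweierstrass a b dphi N).
Proof.
move=> b0 h.
have T n : weak_derivative (fun x => a ^+ n * phi (b ^+ n * x))
    (fun x => (a * b) ^+ n * dphi (b ^+ n * x)).
  rewrite (_ : (fun x => (a * b) ^+ n * _) =
    (fun x => a ^+ n * (b ^+ n * dphi (b ^+ n * x)))).
    apply: weak_derivativeZ; apply: weak_derivative_scale => //.
    exact: exprn_gt0.
  by apply/funext => x; rewrite exprMn mulrA.
elim: N => [|N IH].
  rewrite (_ : weierstrass _ _ _ _ = (fun x => a ^+ 0 * phi (b ^+ 0 * x))).
    rewrite (_ : dweierstrass _ _ _ _ =
      (fun x => (a * b) ^+ 0 * dphi (b ^+ 0 * x)))//.
    by apply/funext => x; rewrite /dweierstrass big_nat1.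
  by apply/funext => x; rewrite /weierstrass big_nat1.
rewrite (_ : weierstrass _ _ _ _ = (fun x => weierstrass a b phi N x +
    a ^+ N.+1 * phi (b ^+ N.+1 * x))); last first.
  by apply/funext => x; rewrite /weierstrass big_nat_recr.
rewrite (_ : dweierstrass _ _ _ _ = (fun x => dweierstrass a b dphi N x +
    (a * b) ^+ N.+1 * dphi (b ^+ N.+1 * x))); last first.
  by apply/funext => x; rewrite /dweierstrass big_nat_recr.
exact: weak_derivativeD.
Qed.

(* Main.v *)
Require Import Defs.
From HB Require Import structures.
From mathcomp Require Import all_boot all_order all_algebra.
From mathcomp Require Import all_classical all_reals all_analysis.
From mathcomp Require Import measurable_realfun ring lra.
Import Order.TTheory GRing.Theory Num.Theory.
Import numFieldNormedType.Exports.
Local Open Scope classical_set_scope.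
Local Open Scope ring_scope.

(** The maps [kick_cl N] and [kick_cl N.-1] differ only in the momentum, by
    [h / 2 * kappa] times the last term [(a * b) ^+ N * dphi (b ^+ N * x)] of
    the Weierstrass sum: the contributions of [V] and of the lower modes cancel,
    and the difference does not depend on [p], so [gamma] contributes only its
    total mass 1. The substitution [u = b ^+ N * x] turns the remaining integral
    over (0,1) into the mean of [dphi ^+ 2] over (0, b ^+ N), which is
    [zeta b dphi N ^+ 2]. This is [L2norm_kick_increment].

    Both consequences follow once [zeta] is bounded below by a positive
    constant ([zeta_lower_bound]): as [a * b > 1], the increments at fixed [h]
    stay away from 0, and in general [h N * (a * b) ^+ N] is at most a constant
    times the norm of the increment.

    The lower bound comes from periodicity: the interval (0, b ^+ N) contains at
    least half of its length in complete periods, so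
    [zeta ^+ 2] is at least half of the mean of [dphi ^+ 2] over one period. But
    [dphi] is only some weak derivative of the periodic function [phi], so its
    periodicity almost everywhere, and also its local square integrability,
    must be derived from the uniqueness of weak derivatives
    ([weak_derivative_ae_unique]): [dphi] agrees almost everywhere with its
    translate by 1 and with the square integrable weak derivative given by
    [H1per].

    Uniqueness is the fundamental lemma of the calculus of variations. Smooth
    functions built from [exp (- 1 / t)] converge boundedly to the indicator of
    an open interval, so a locally integrable function orthogonal to all test
    functions has zero integral over every open interval, hence vanishes at each
    of its Lebesgue points. *)

(** * Smoothness of products and affine reparametrisations *)

(** The recursion differentiates first, unlike [derive1n], so that closure under
    products is a plain induction, without the Leibniz formula. *)
Fixpoint times_derivable {R : realType} (n : nat) (f : R -> R) : Prop :=
  if n is m.+1 then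
    (forall x, derivable f x 1) /\ times_derivable m (derive1 f)
  else True.

Lemma times_derivable_derive1n {R : realType} (n : nat) (f : R -> R) :
  times_derivable n.+1 f -> forall x, derivable (derive1n n f) x 1.
Proof.
elim: n f => [f [df _] //|n IH f [_ df] x].
by rewrite /derive1n iterSr; exact: IH.
Qed.

Lemma times_derivableW {R : realType} (n : nat) (f : R -> R) :
  times_derivable n.+1 f -> times_derivable n f.
Proof. by elim: n f => [//|n IH] f [df dn]; split => //; exact: IH. Qed.

Lemma times_derivableD {R : realType} (n : nat) (f g : R -> R) :
  times_derivable n f -> times_derivable n g ->
  times_derivable n (fun x => f x + g x).
Proof.
elim: n f g => [//|n IH] f g [df dnf] [dg dng]; split.
  by move=> x; exact: derivableD.
rewrite [X in times_derivable n X](_ : _ = (fun x => derive1 f x + derive1 g x)).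
  exact: IH.
by apply/funext => x; rewrite !derive1E deriveD.
Qed.

Lemma times_derivableM {R : realType} (n : nat) (f g : R -> R) :
  times_derivable n f -> times_derivable n g ->
  times_derivable n (fun x => f x * g x).
Proof.
elim: n f g => [//|n IH] f g df dg; split.
  by move=> x; apply: derivableM; [exact: df.1|exact: dg.1].
rewrite [X in times_derivable n X](_ : _ =
    (fun x => f x * derive1 g x + derive1 f x * g x)).
  by apply: times_derivableD; apply: IH;
    [exact: times_derivableW|exact: dg.2|exact: df.2|exact: times_derivableW].
apply/funext => x; rewrite !derive1E deriveM; [|exact: df.1|exact: dg.1].
by rewrite [X in _ + X]mulrC.
Qed.

Lemma times_derivable_affine {R : realType} (n : nat) (f : R -> R) (k c d : R) :
  times_derivable n f -> times_derivable n (fun x => k * f (c * x + d)).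
Proof.
elim: n f k => [//|n IH] f k [df dn].
have D (x : R) : is_derive x (1 : R) (fun x => f (c * x + d)) (c * derive1 f (c * x + d)).
  have Dc : is_derive x (1 : R) (fun x => c * x + d) c.
    by apply: is_derive_eq; rewrite addr0 /GRing.scale/= mulr1.
  have Df : is_derive (c * x + d) (1 : R) f (derive1 f (c * x + d)).
    by rewrite derive1E; apply/derivableP.
  by have := @is_derive1_comp _ f (fun x => c * x + d) x _ _ Df Dc; rewrite mulrC.
split.
  by move=> x; apply: derivableM => //; exact: (@ex_derive _ _ _ _ _ _ _ (D x)).
rewrite [X in times_derivable n X](_ : _ =
    (fun x => (k * c) * derive1 f (c * x + d))); first exact: IH.
apply/funext => x; rewrite derive1Ml; last exact: (@ex_derive _ _ _ _ _ _ _ (D x)).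
by rewrite derive1E (@derive_val _ _ _ _ _ _ _ (D x)) mulrA.
Qed.

(** * The flat functions exp(-1/t) and test functions *)

(** Each monomial satisfies [s ^+ i <= i`! * expR s], a single term of the
    exponential series, which yields an explicit constant. *)
Lemma horner_expRN_bounded {R : realType} (Q : {poly R}) :
  exists C : R, 0 <= C /\ forall s : R, 0 <= s -> `|Q.[s] * expR (- s)| <= C.
Proof.
exists (\sum_(i < size Q) `|Q`_i| * (i`!)%:R); split.
  by apply: sumr_ge0 => i _; apply: mulr_ge0.
move=> s s0; rewrite normrM (ger0_norm (expR_ge0 _)) expRN ler_pdivrMr ?expR_gt0//.
rewrite horner_coef (le_trans (ler_norm_sum _ _ _))// mulr_suml ler_sum// => i _.
rewrite normrM -mulrA ler_wpM2l// normrX (ger0_norm s0).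
case: (nat_of_ord i) => [|m].
  by rewrite expr0 fact0 mul1r -expR0 ler_expR.
rewrite -ler_pdivrMl ?ltr0n ?fact_gt0// mulrC.
by apply: le_trans (expR_ge1Dxn m s0); rewrite lerDr.
Qed.

(** The polynomial factor makes the family stable under differentiation, see
    [is_derive_flat]. *)
Definition flat {R : realType} (P : {poly R}) (t : R) : R :=
  if 0 < t then P.[t^-1] * expR (- t^-1) else 0.

(** Quadratic decay at 0 gives both continuity and a zero derivative there. *)
Lemma flat_quadratic {R : realType} (P : {poly R}) :
  exists C : R, 0 <= C /\ forall t : R, `|flat P t| <= C * t ^+ 2.
Proof.
have [C [C0 hC]] := horner_expRN_bounded ('X^2 * P).
exists C; split => // t; rewrite /flat; case: ifPn => [t0|_]; last first.
  by rewrite normr0 mulr_ge0// sqr_ge0.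
have := hC t^-1; rewrite invr_ge0 (ltW t0) => /(_ isT).
rewrite hornerM hornerXn -mulrA normrM mulrC -ler_pdivlMr; last first.
  by rewrite normr_gt0 expf_neq0// invr_eq0 gt_eqF.
by rewrite [X in _ / X]ger0_norm ?sqr_ge0// exprVn invrK.
Qed.

(** With [s = t^-1], the derivative of [P.[s] * expR (- s)] in [t] is
    [s ^+ 2 * (P.[s] - P^`().[s]) * expR (- s)], again of the same form. *)
Lemma is_derive_flat {R : realType} (P : {poly R}) (t : R) :
  is_derive t 1 (flat P) (flat ('X^2 * (P - P^`())) t).
Proof.
have [t0|t0|->] := ltgtP t 0.
- rewrite {2}/flat ltNge (ltW t0)/=.
  apply: (@near_eq_is_derive _ _ _ (cst 0)) => //.
  near=> x; rewrite /flat ifN// -leNgt ltW//.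
  by near: x; exact: lt_nbhsl.
- rewrite {2}/flat t0.
  apply: (@near_eq_is_derive _ _ _ (fun x : R => P.[x^-1] * expR (- x^-1)) (flat P)) => //.
    near=> x; rewrite /flat ifT//.
    by near: x; exact: lt_nbhsr.
  have D1 : is_derive t (1 : R) (fun x : R => x^-1) (- t ^- 2).
    have := @is_deriveV _ id t _ 1 (lt0r_neq0 t0) (is_derive_id _ _); rewrite /GRing.scale/= mulr1; exact.
  have D2 : is_derive t (1 : R) (fun x : R => P.[x^-1]) (P^`().[t^-1] * - t ^- 2).
    by have := @is_derive1_comp _ (horner P) (fun x => x^-1) t _ _ (is_derive_poly P t^-1) D1.
  have D3 : is_derive t (1 : R) (fun x : R => expR (- x^-1))
      (expR (- t^-1) * t ^- 2).
    by have := @is_derive1_comp _ expR (fun x => - x^-1) t _ _ (is_derive_expR (- t^-1)) (is_deriveN D1); rewrite opprK.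
  apply: (@is_derive_eq _ _ _ _ _ _ _ _ (is_deriveM D2 D3)).
  rewrite hornerM hornerXn hornerD hornerN /GRing.scale/= exprVn.
  ring.
- rewrite {2}/flat ltxx.
  have [C [C0 hC]] := flat_quadratic P.
  have cv : (fun h : R => h^-1 *: (flat P (h *: 1 + 0) - flat P 0)) @ 0^' --> (0 : R).
    apply/cvgr0Pnorm_le => e e0; near=> h.
    rewrite {2}/flat ltxx subr0 addr0 /GRing.scale/= mulr1.
    rewrite normrM normfV mulrC ler_pdivrMr; last first.
      by rewrite normr_gt0; near: h; exact: nbhs_dnbhs_neq.
    rewrite (le_trans (hC h))// -real_normK ?num_real// expr2 mulrA.
    rewrite ler_wpM2r// (@le_trans _ _ ((C + 1) * `|h|))//.
      by rewrite ler_wpM2r// lerDl.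
    rewrite mulrC -ler_pdivlMr ?ltr_wpDl//.
    near: h; apply: dnbhs0_le.
    by rewrite divr_gt0// ltr_wpDl.
  apply: DeriveDef; first by apply/cvg_ex; exists 0.
  by apply/cvg_lim.
Unshelve. all: by end_near. Qed.

Lemma times_derivable_flat {R : realType} (n : nat) (P : {poly R}) :
  times_derivable n (flat P).
Proof.
elim: n P => [//|n IH] P; split.
  by move=> x; apply: (@ex_derive _ _ _ _ _ _ _ (is_derive_flat P x)).
rewrite (_ : derive1 _ = flat ('X^2 * (P - P^`()))); first exact: IH.
by apply/funext => x; rewrite derive1E (@derive_val _ _ _ _ _ _ _ (is_derive_flat P x)).
Qed.

(** A sequence of smooth functions supported in [u, v] that increases to the
    indicator of ]u, v[; steepening the flat function avoids any smooth step of
    height exactly 1. *)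
Definition bump {R : realType} (u v : R) (n : nat) (x : R) : R :=
  flat 1 (n.+1%:R * (x - u)) * flat 1 (n.+1%:R * (v - x)).

Lemma flat1_ge0_le1 {R : realType} (t : R) : 0 <= flat 1 t <= 1.
Proof.
rewrite /flat; case: ifPn => t0; last by rewrite lexx ler01.
by rewrite hornerC mul1r expR_ge0/= expR_le1 oppr_le0 invr_ge0 ltW.
Qed.

Lemma norm_bump_le1 {R : realType} (u v : R) (n : nat) (x : R) :
  `|bump u v n x| <= 1.
Proof.
rewrite /bump normrM -[leRHS]mulr1.
have h t : `|flat 1 t| <= 1 :> R.
  by have /andP[h0 h1] := flat1_ge0_le1 t; rewrite ger0_norm.
by apply: ler_pM.
Qed.

Lemma bump_out {R : realType} (u v : R) (n : nat) (x : R) :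
  ~ (u < x < v) -> bump u v n x = 0.
Proof.
move=> nx; rewrite /bump /flat !pmulr_rgt0// !subr_gt0.
by case: ltP => ux; case: ltP => xv; rewrite ?mul0r ?mulr0//; case: nx; rewrite ux.
Qed.

Lemma cvg_bump {R : realType} (u v x : R) :
  u < x < v -> bump u v n x @[n --> \oo] --> (1 : R).
Proof.
move=> /andP[ux xv].
have h (t : R) : 0 < t -> flat 1 (n.+1%:R * t) @[n --> \oo] --> (1 : R).
  move=> t0.
  rewrite [X in X @ _](_ : _ = (fun n => expR (- (n.+1%:R^-1 * t^-1)))).
    rewrite -[X in _ --> X]expR0; apply: continuous_cvg; first exact: continuous_expR.
    rewrite -oppr0; apply: cvgN; rewrite -[X in _ --> X](mul0r t^-1).
    by apply: cvgMl; exact: cvg_harmonic.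
  by apply/funext => n; rewrite /flat pmulr_rgt0// t0 hornerC mul1r invfM.
by rewrite -[X in _ --> X]mulr1; apply: cvgM; apply: h; rewrite subr_gt0.
Qed.

Lemma test_bump {R : realType} (u v : R) (n : nat) : test_function (bump u v n).
Proof.
split.
  move=> m; apply: times_derivable_derive1n; apply: times_derivableM.
    rewrite [X in times_derivable _ X](_ : _ =
      (fun x => 1 * flat 1 (n.+1%:R * x + - (n.+1%:R * u)))).
      exact/times_derivable_affine/times_derivable_flat.
    by apply/funext => x; rewrite mul1r mulrBr.
  rewrite [X in times_derivable _ X](_ : _ =
      (fun x => 1 * flat 1 (- n.+1%:R * x + n.+1%:R * v))).
    exact/times_derivable_affine/times_derivable_flat.
  by apply/funext => x; rewrite mul1r mulrBr addrC mulNr.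
apply: (subclosed_compact _ (@segment_compact _ u v)); first exact: closed_closure.
rewrite [X in _ `<=` X](closure_id _).1; last exact: itv_closed.
apply: closureS => x /= /eqP bx; apply: contrapT => nx; apply: bx; apply: bump_out.
by move=> /andP[ux xv]; apply: nx; rewrite /= in_itv/= !ltW.
Qed.

(** * Uniqueness of weak derivatives *)

(** Dominated convergence along [bump u v n], with [`|w|] as dominating
    function. *)
Lemma Rintegral_itv_eq0 {R : realType} (w : R -> R) (u v : R) :
  locally_integrable setT w ->
  (forall psi, test_function psi ->
    \int[lebesgue_measure]_x (w x * psi x) = 0) ->
  (\int[lebesgue_measure]_(x in `]u, v[) (w x)%:E = 0)%E.
Proof.
move=> lw w0; have [mw _ lw'] := lw.
have iw : lebesgue_measure.-integrable `]u, v[ (EFin \o w).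
  apply: (@integrableS _ _ _ lebesgue_measure `[u, v]%classic `]u, v[%classic) => //.
    exact: subset_itv_oo_cc.
  apply/integrableP; split; first exact/measurable_EFinP/measurable_funTS.
  by apply: lw' => //; exact: segment_compact.
have mb n : measurable_fun setT (bump u v n).
  by apply: continuous_measurable_fun; case: (test_continuous (test_bump u v n)).
have mwb n : measurable_fun setT (fun x => w x * bump u v n x).
  exact: measurable_funM.
have mE n : measurable_fun `]u, v[ (fun x => (w x * bump u v n x)%:E).
  by apply/measurable_EFinP; exact: measurable_funTS (mwb n).
have iwb n : lebesgue_measure.-integrable `]u, v[ (fun x => (w x * bump u v n x)%:E).
  apply: (@le_integrable _ (measurableTypeR R) R lebesgue_measure _ _ _ (EFin \o w)); [exact: measurable_itv|exact: mE| |exact: iw].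
  by move=> x _; rewrite lee_fin normrM ler_piMr// norm_bump_le1.
have [] := @dominated_convergence _ _ _ lebesgue_measure `]u, v[%classic ltac:(exact: measurable_itv)
  (fun n x => (w x * bump u v n x)%:E) (EFin \o w) (fun x => `|w x|%:E).
- exact: mE.
- exact: measurable_int iw.
- apply: aeW => x /=; rewrite in_itv/= => xuv; apply: cvg_EFin.
    exact: nearW.
  rewrite -[X in _ --> X]mulr1; apply: cvgM; first exact: cvg_cst.
  exact: cvg_bump.
- exact: integrable_abse iw.
- apply: aeW => x n _; rewrite lee_fin normrM.
  by rewrite ler_piMr// norm_bump_le1.
move=> _ _; rewrite [X in X @ _](_ : _ = cst 0%E); last first.
  apply/funext => n /=.
  have := w0 _ (test_bump u v n).
  rewrite (_ : Rintegral _ _ _ = fine (\int[lebesgue_measure]_(x in `]u, v[) (w x * bump u v n x)%:E)).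
    have /fineK {2}<- : (\int[lebesgue_measure]_(x in `]u, v[) (w x * bump u v n x)%:E)%E
        \is a fin_num by apply: integrable_fin_num (iwb n); exact: measurable_itv.
    by move=> ->.
  rewrite /Rintegral [in RHS]integral_mkcond; congr fine; apply: eq_integral => x _.
  rewrite patchE; case: ifPn => // /negP xuv; rewrite bump_out ?mulr0// => xx.
  by apply: xuv; rewrite inE /= in_itv.
by move=> /cvg_unique; apply; [exact: ereal_hausdorff|exact: cvg_cst].
Qed.

(** At a Lebesgue point, [w x] is the limit of the averages of [w] over the balls
    centered at [x], which are all zero. *)
Lemma locally_integrable_ae_eq0 {R : realType} (w : R -> R) :
  locally_integrable setT w ->
  (forall u v, \int[lebesgue_measure]_(x in `]u, v[) (w x)%:E = 0)%E ->
  {ae lebesgue_measure, forall x, w x = 0}.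
Proof.
move=> lw w0; have := lebesgue_differentiation lw.
pose E (x : R) n := ball x (n.+1%:R^-1 : R).
have hE x : nicely_shrinking x (E x).
  split; first by move=> n; exact: measurable_ball.
  exists (1, (fun n => (n.+1%:R^-1)%:pos)); split => //= [|n|n].
  - exact: cvg_harmonic.
  - exact: subset_refl.
  - by rewrite mul1e.
apply: filterS; first exact: (ae_filter_ringOfSetsType lebesgue_measure).
move=> x lx.
have := @nice_lebesgue_differentiation _ _ hE _ lw _ lx.
rewrite [X in X @ _](_ : _ = cst 0%E); last first.
  by apply/funext => n; rewrite /E ball_itv w0 mule0.
move=> h; apply: EFin_inj; move: h => /cvg_unique; apply.
  exact: ereal_hausdorff.
exact: cvg_cst.
Qed.

Lemma weak_derivative_ae_unique {R : realType} (f g1 g2 : R -> R) :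
  weak_derivative f g1 -> weak_derivative f g2 ->
  {ae lebesgue_measure, forall x, g1 x = g2 x}.
Proof.
move=> [_ l1 h1] [_ l2 h2].
have lw : locally_integrable setT (g1 \- g2)%R by exact: locally_integrableB.
have : {ae lebesgue_measure, forall x, (g1 \- g2)%R x = 0}.
  apply: locally_integrable_ae_eq0 => // u v; apply: Rintegral_itv_eq0 => // psi tpsi.
  have [cpsi _] := test_continuous tpsi; have [_ K] := tpsi.
  under eq_Rintegral do rewrite mulrBl.
  rewrite RintegralB//; [|exact: integrable_test..].
  by rewrite -[X in X - _]opprK -h1// h2// opprK subrr.
apply: filterS; first exact: (ae_filter_ringOfSetsType lebesgue_measure).
by move=> x /eqP; rewrite subr_eq0 => /eqP.
Qed.

(** * Translation invariance *)

Lemma lebesgue_measure_shift {R : realType} (c : R) (A : set R) :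
  measurable A ->
  lebesgue_measure A = lebesgue_measure ((fun x => x + c) @^-1` A).
Proof.
move=> mA.
pose g := (fun x => x + c) : measurableTypeR R -> measurableTypeR R.
have mg : measurable_fun setT g by exact: measurable_funD.
rewrite (@lebesgue_measure_unique R (pushforward (@lebesgue_measure R) g) _ A)//.
move=> _ [[u v]] _ <-.
change (lebesgue_measure `]u, v] =
  lebesgue_measure (g @^-1` `]u, v]))%E.
rewrite (_ : g @^-1` _ = `]u - c, v - c]%classic); last first.
  by apply/seteqP; split => x /=; rewrite !in_itv/= ltrBlDr lerBrDr.
rewrite !lebesgue_measure_itv/= !lte_fin ltrD2r.
by case: ifPn => // _; rewrite -!EFinD opprB addrA subrK.
Qed.

Lemma ge0_integral_shift {R : realType} (c : R) (f : R -> \bar R) :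
  measurable_fun setT f -> (forall x, 0 <= f x)%E ->
  (\int[lebesgue_measure]_x f x = \int[lebesgue_measure]_x f (x + c)%R)%E.
Proof.
move=> mf f0.
pose g := (fun x => x + c) : measurableTypeR R -> measurableTypeR R.
have mg : measurable_fun setT g by exact: measurable_funD.
transitivity (\int[pushforward (@lebesgue_measure R) g]_y f y)%E; last first.
  by rewrite (@ge0_integral_pushforward _ _ _ _ _ g)// preimage_setT.
by apply: eq_measure_integral => A mA _; exact: lebesgue_measure_shift.
Qed.

Lemma Rintegral_shift {R : realType} (c : R) (f : R -> R) :
  measurable_fun setT f ->
  \int[lebesgue_measure]_x f x = \int[lebesgue_measure]_x f (x + c).
Proof.
move=> /measurable_EFinP mf; rewrite /Rintegral integralE [in RHS]integralE.
rewrite (ge0_integral_shift c _ (measurable_funepos mf))//.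
rewrite [X in (_ - X)%E](ge0_integral_shift c _ (measurable_funeneg mf))//.
congr (fine (_ - _)%E); apply: eq_integral => x _.
  by rewrite !funeposE.
by rewrite !funenegE.
Qed.

Lemma integral_set_shift {R : realType} (c : R) (K : set R) (f : R -> \bar R) :
  measurable K -> measurable_fun setT f -> (forall x, 0 <= f x)%E ->
  (\int[lebesgue_measure]_(x in K) f x =
   \int[lebesgue_measure]_(x in (fun x => (x + c)%R) @^-1` K) f (x + c)%R)%E.
Proof.
move=> mK mf f0; rewrite integral_mkcond (ge0_integral_shift c); last 2 first.
- by apply: (iffLR (measurable_restrictT _ mK)); exact: measurable_funTS.
- by move=> x; apply: erestrict_ge0.
by rewrite [in RHS]integral_mkcond.
Qed.

Lemma locally_integrable_shift {R : realType} (c : R) (f : R -> R) :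
  locally_integrable setT f -> locally_integrable setT (fun x => f (x + c)).
Proof.
move=> [mf oT fK].
have mfc : measurable_fun setT (fun x : R => f (x + c)).
  by apply: (measurableT_comp mf); exact: measurable_funD.
split => // K KT cK.
have cK' : compact ((fun x => x - c) @^-1` K).
  rewrite (_ : _ @^-1` _ = [set x + c | x in K]).
    apply: continuous_compact => //; apply: continuous_subspaceT => x.
    by apply: continuousD => //; exact: cvg_cst.
  apply/seteqP; split => x /=; first by exists (x - c); rewrite ?subrK.
  by move=> [y Ky <-]; rewrite addrK.
have mK := compact_measurable cK.
rewrite (integral_set_shift (- c)) => //.
  by under eq_integral do rewrite subrK; exact: fK.
by apply/measurable_EFinP; exact: measurableT_comp.
Qed.

Lemma derive1_shift {R : realType} (c : R) (f : R -> R) :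
  derive1 (fun x => f (x + c)) = (fun x => derive1 f (x + c)).
Proof.
apply/funext => x; rewrite /derive1.
by under [X in lim (X @ _)]eq_fun do rewrite -addrA.
Qed.

Lemma derive1n_shift {R : realType} (c : R) (f : R -> R) (n : nat) :
  derive1n n (fun x => f (x + c)) = (fun x => derive1n n f (x + c)).
Proof. by elim: n => [//|n IH]; rewrite derive1nS IH derive1_shift. Qed.

Lemma derivable_shift {R : realType} (c : R) (f : R -> R) (x : R) :
  derivable f (x + c) 1 -> derivable (fun x => f (x + c)) x 1.
Proof.
rewrite /derivable /= => h; by under [X in X @ _]eq_fun do rewrite /= -addrA.
Qed.

Lemma test_shift {R : realType} (c : R) (psi : R -> R) :
  test_function psi -> test_function (fun x => psi (x + c)).
Proof.
move=> [d K]; split.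
  by move=> n x; rewrite derive1n_shift; exact: derivable_shift.
have cK' : compact [set x - c | x in closure [set x | psi x != 0]].
  apply: continuous_compact => //; apply: continuous_subspaceT => x.
  by apply: continuousB => //; exact: cvg_cst.
apply: (subclosed_compact _ cK'); first exact: closed_closure.
rewrite [X in _ `<=` X](closure_id _).1; last exact: compact_closed.
apply: closureS => x /= px; exists (x + c); last by rewrite addrK.
exact: subset_closure.
Qed.

Lemma weak_derivative_shift {R : realType} (c : R) (f g : R -> R) :
  weak_derivative f g ->
  weak_derivative (fun x => f (x + c)) (fun x => g (x + c)).
Proof.
move=> [fi gi h]; split; [exact: locally_integrable_shift..|].
move=> psi tpsi; have tpsi' := test_shift (- c) _ tpsi.
have [cp cdp] := test_continuous tpsi'.
have := h _ tpsi'; have [mf _ _] := fi; have [mg _ _] := gi.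
rewrite (Rintegral_shift c); last first.
  by apply: measurable_funM => //; exact: continuous_measurable_fun.
rewrite [X in _ = - X](Rintegral_shift c); last first.
  by apply: measurable_funM => //; exact: continuous_measurable_fun.
rewrite derive1_shift.
by under eq_Rintegral do rewrite addrK; under [in RHS]eq_Rintegral do rewrite addrK.
Qed.

(** The translate by [T] of [g] is another weak derivative of the same
    function, so uniqueness applies. *)
Lemma weak_derivative_periodic {R : realType} (f g : R -> R) (T : R) :
  periodic f T -> weak_derivative f g ->
  {ae lebesgue_measure, forall x, g (x + T) = g x}.
Proof.
move=> pf fg; apply: (weak_derivative_ae_unique f) => //.
by rewrite (_ : f = (fun x => f (x + T))); [exact: weak_derivative_shift|exact/funext].
Qed.

(** Splitting off the first period leaves ]1, n + 1], which a translation by 1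
    takes back to ]0, n]; half-open intervals make the splitting exact. *)
Lemma integral_ae_periodic {R : realType} (q : R -> \bar R) (n : nat) :
  measurable_fun setT q -> (forall x, 0 <= q x)%E ->
  {ae lebesgue_measure, forall x, q (x + 1) = q x} ->
  (\int[lebesgue_measure]_(x in `]0%R, n%:R]) q x =
   n%:R%:E * \int[lebesgue_measure]_(x in `]0%R, 1%R]) q x)%E.
Proof.
move=> mq q0 pq; elim: n => [|n IH].
  by rewrite set_itv_ge ?bnd_simp ?ltxx// integral_set0 mul0e.
have -> : `]0, n.+1%:R]%classic = `]0, 1] `|` `]1, (n.+1%:R : R)].
  by rewrite -itv_bndbnd_setU ?bnd_simp ?ler01// ler1n.
rewrite ge0_integral_setU//=; [|exact: measurable_funTS|]; last first.
  apply: lt_disjoint => x y; rewrite !in_itv/= => /andP[_ x1] /andP[y1 _].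
  exact: le_lt_trans y1.
rewrite [X in (_ + X)%E](integral_set_shift 1)//.
rewrite (_ : _ @^-1` _ = `]0, n%:R]%classic); last first.
  by apply/seteqP; split => x /=; rewrite !in_itv/= ltrDr -(natr1 n) lerD2r.
have -> : (\int[lebesgue_measure]_(x in `]0%R, n%:R]) q (x + 1)%R =
    \int[lebesgue_measure]_(x in `]0%R, n%:R]) q x)%E.
  apply: ge0_ae_eq_integral => //.
  - apply: measurable_funTS; apply: (measurableT_comp mq).
    exact: measurable_funD.
  - exact: measurable_funTS.
  - apply: filterS pq; first exact: (ae_filter_ringOfSetsType lebesgue_measure).
    by move=> x ->.
rewrite IH -{1}[X in (X + _)%E]mul1e -ge0_muleDl ?lee_fin//.
by rewrite -EFinD addrC natr1.
Qed.

(** * The normalisation zeta *)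

Lemma L2loc_integral_lty {R : realType} (f : R -> R) (T : R) :
  L2loc f -> (\int[lebesgue_measure]_(x in `]0%R, T[) (`|f x| ^+ 2)%:E < +oo)%E.
Proof.
move=> [mf [_ _ fK]].
apply: (@le_lt_trans _ _ (\int[lebesgue_measure]_(x in `[0%R, T]) (`|f x| ^+ 2)%:E)%E).
  apply: ge0_subset_integral => //.
  - apply/measurable_EFinP; apply: measurable_funTS.
    by apply: measurable_funX; exact: measurableT_comp.
  - exact: subset_itv_oo_cc.
have := fK _ (@subsetT _ _) (@segment_compact _ 0 T).
by under eq_integral do rewrite normrX.
Qed.

(** [H1per] makes only one weak derivative locally square integrable; uniqueness
    transfers this to [dphi]. *)
Lemma H1per_weak_derivative_lty {R : realType} (phi dphi : R -> R) (T : R) :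
  H1per phi -> weak_derivative phi dphi ->
  (\int[lebesgue_measure]_(x in `]0%R, T[) (`|dphi x| ^+ 2)%:E < +oo)%E.
Proof.
move=> [_ [_ [g wg g2]]] wd; have [_ [md _ _] _] := wd; have [mg _] := g2.
rewrite (_ : (\int[_]_(x in _) _ = \int[lebesgue_measure]_(x in `]0%R, T[) (`|g x| ^+ 2)%:E)%E).
  exact: L2loc_integral_lty.
have m2 (f : R -> R) : measurable_fun setT f ->
    measurable_fun `]0, T[ (fun x => (`|f x| ^+ 2)%:E).
  move=> mf; apply/measurable_EFinP; apply: measurable_funTS.
  by apply: measurable_funX; exact: measurableT_comp.
apply: ge0_ae_eq_integral => //; [exact: m2|exact: m2|].
apply: filterS (weak_derivative_ae_unique _ _ _ wd wg).
  exact: (ae_filter_ringOfSetsType lebesgue_measure).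
by move=> x ->.
Qed.

(** The definition of [zeta] truncates an infinite integral to 0; finiteness shows
    that it is the true mean square. *)
Lemma zetaE {R : realType} (b : R) (phi dphi : R -> R) (N : nat) :
  0 < b -> H1per phi -> weak_derivative phi dphi ->
  (zeta b dphi N ^+ 2)%:E = ((b ^+ N)^-1%R%:E *
    \int[lebesgue_measure]_(u in `]0%R, (b ^+ N)%R[) (`|dphi u| ^+ 2)%:E)%E.
Proof.
move=> b0 hphi wd; rewrite /zeta sqr_sqrtr; last first.
  by rewrite mulr_ge0 ?invr_ge0 ?exprn_ge0 ?(ltW b0)//; apply: Rintegral_ge0.
rewrite EFinM /Rintegral fineK// ge0_fin_numE ?integral_ge0//.
exact: H1per_weak_derivative_lty hphi wd.
Qed.

(** An interval of length [T >= 1] contains [truncn T >= T / 2] complete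
    periods. *)
Lemma zeta_sqr_ge {R : realType} (b : R) (phi dphi : R -> R) (N : nat) :
  1 < b -> H1per phi -> weak_derivative phi dphi ->
  (2^-1%:E * \int[lebesgue_measure]_(x in `]0%R, 1%R[) (`|dphi x| ^+ 2)%:E
     <= (zeta b dphi N ^+ 2)%:E)%E.
Proof.
move=> b1 hphi wd; have b0 : 0 < b by exact: lt_trans b1.
rewrite (zetaE _ _ _ _ b0 hphi wd).
set T := b ^+ N; set q := fun x => (`|dphi x| ^+ 2)%:E.
have T1 : 1 <= T by rewrite exprn_ege1// ltW.
have [_ [md _ _] _] := wd.
have mq : measurable_fun setT q.
  apply/measurable_EFinP; apply: measurable_funX.
  exact: measurableT_comp.
have q0 x : (0 <= q x)%E by rewrite lee_fin.
have pq : {ae lebesgue_measure, forall x, q (x + 1) = q x}.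
  apply: filterS (weak_derivative_periodic _ _ _ hphi.1 wd).
    exact: (ae_filter_ringOfSetsType lebesgue_measure).
  by rewrite /q => x ->.
have n1 : 1 <= (Num.truncn T)%:R :> R.
  by rewrite ler1n -ltnS -(@ltr_nat R) (le_lt_trans T1)// truncnS_gt.
have nT : (Num.truncn T)%:R <= T by rewrite truncn_le// (le_trans _ T1).
have Tn : T <= 2 * (Num.truncn T)%:R.
  by have := ltW (truncnS_gt T); rewrite -natr1; lra.
apply: (@le_trans _ _ (T^-1%:E * \int[lebesgue_measure]_(x in `]0%R, (Num.truncn T)%:R[) q x)%E).
  rewrite (integral_itv_bndo_bndc (r := 1)); last exact: measurable_funTS.
  rewrite [in leRHS]integral_itv_bndo_bndc; last exact: measurable_funTS.
  rewrite integral_ae_periodic// muleA -EFinM.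
  apply: lee_wpmul2r; first exact: integral_ge0.
  by rewrite lee_fin mulrC ler_pdivlMr; lra.
apply: lee_wpmul2l; first by rewrite lee_fin invr_ge0 (le_trans _ T1).
apply: ge0_subset_integral => //; first exact: measurable_funTS.
by apply: subset_itvl; rewrite bnd_simp.
Qed.

Lemma zeta_lower_bound {R : realType} (b : R) (phi dphi : R -> R) :
  1 < b -> H1per phi -> weak_derivative phi dphi -> (0 < L2norm01 dphi)%E ->
  exists2 d : R, 0 < d & forall N, d <= zeta b dphi N.
Proof.
move=> b1 hphi wd dphi0.
have I0 : (0 < \int[lebesgue_measure]_(x in `]0%R, 1%R[) (`|dphi x| ^+ 2)%:E)%E.
  by apply: gt0_poweR dphi0; [rewrite invr_gt0|exact: integral_ge0].
have := H1per_weak_derivative_lty _ _ 1 hphi wd; move: I0.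
have := zeta_sqr_ge b _ _ _ b1 hphi wd.
case: (integral _ _ _) => [I h I0 _| //|//].
exists (Num.sqrt (2^-1 * I)); first by rewrite sqrtr_gt0 mulr_gt0.
move=> N; rewrite -[leRHS]ger0_norm ?sqrtr_ge0// -sqrtr_sqr ler_wsqrtr//.
by have := h N; rewrite -EFinM lee_fin.
Qed.

(** * The increments of the kick maps *)

Lemma L2norm_kick_increment {R : realType} (phi dphi : R -> R) (a b kappa : R)
    (V : R -> R) (gamma : probability (measurableTypeR R) R) (h : R) (N : nat) :
  H1per phi -> weak_derivative phi dphi -> 0 < a -> 0 < b -> 0 < h ->
  L2norm gamma (kick_cl V kappa a b dphi N.+1 h \- kick_cl V kappa a b dphi N h) =
  (`|kappa| * h / 2 * (a * b) ^+ N.+1 * zeta b dphi N.+1)%:E.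
Proof.
move=> hphi wd a0 b0 h0; have [_ [md _ _] _] := wd.
set c := kappa * h / 2 * (a * b) ^+ N.+1.
set B := b ^+ N.+1; have B0 : 0 < B by exact: exprn_gt0.
pose q x := (`|dphi x| ^+ 2)%:E.
have mq : measurable_fun setT q.
  apply/measurable_EFinP; apply: measurable_funX.
  exact: measurableT_comp.
have q0 x : (0 <= q x)%E by rewrite lee_fin.
rewrite /L2norm.
rewrite (_ : integral _ _ _ =
  \int[lebesgue_measure]_(x in `]0%R, 1%R[) ((c ^+ 2)%:E * q (B * x)%R))%E; last first.
  apply: eq_integral => x _.
  rewrite (_ : (fun p => _) = cst (c ^+ 2 * `|dphi (B * x)| ^+ 2)%:E).
    by rewrite integral_cst//= probability_setT mule1 EFinM.
  apply/funext => p; rewrite /euclid /kick_cl /= sqr_sqrtr ?addr_ge0 ?sqr_ge0//.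
  rewrite /dpotential /dweierstrass [X in _ + kappa * X]big_nat_recr//= -/B.
  by congr EFin; rewrite real_normK ?num_real// /c; field.
rewrite ge0_integralZl//=; last 2 first.
- apply: measurable_funTS; apply: (measurableT_comp mq).
  exact: measurable_funM.
- by rewrite lee_fin sqr_ge0.
have -> : (\int[lebesgue_measure]_(x in `]0%R, 1%R[) q (B * x)%R = (zeta b dphi N.+1 ^+ 2)%:E)%E.
  rewrite (zetaE _ _ _ _ b0 hphi wd) -/B.
  rewrite [in RHS]integral_mkcond (ge0_integral_scale B0); last 2 first.
  - by apply: (iffLR (measurable_restrictT _ (measurable_itv _))); exact: measurable_funTS.
  - by move=> x; apply: erestrict_ge0.
  rewrite muleA -EFinM mulVf ?gt_eqF// mul1e integral_mkcond.
  apply: eq_integral => x _; rewrite !patchE !mem_setE /= !in_itv/=.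
  have -> : (B * x < B) = (x < 1) by rewrite -[X in _ < X]mulr1 ltr_pM2l.
  by rewrite pmulr_rgt0.
rewrite -EFinM -exprMn poweR_EFin powR12_sqrt ?sqr_ge0// sqrtr_sqr.
rewrite normrM [`|zeta _ _ _|]ger0_norm ?sqrtr_ge0// /c !normrM.
by rewrite (gtr0_norm h0) normfV (ger0_norm (ler0n _ 2)) (@gtr0_norm _ (_ ^+ _)) ?exprn_gt0 ?mulr_gt0.
Qed.

Theorem theorem3p5 (R : realType) (phi dphi : R -> R) (a b kappa : R)
    (V : R -> R) (gamma : probability (measurableTypeR R) R)
    (Hphi : H1per phi) (Hdphi : weak_derivative phi dphi)
    (Hdphi_gt0 : (0 < L2norm01 dphi)%E)
    (Hb : 1 < b) (Ha0 : 0 < a) (Ha1 : a < 1) (Hab : 1 < a * b)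
    (Hkappa : kappa != 0)
    (HV : forall x : R, 0 < x -> derivable V x 1) :
  let K := kick_cl V kappa a b dphi in
  [/\ forall h : nat -> R, (forall N, 0 < h N) ->
        forall N : nat, (1 <= N)%N ->
          L2norm gamma (K N (h N) \- K N.-1 (h N)) =
          (`|kappa| * h N / 2 * (a * b) ^+ N * zeta b dphi N)%:E,
      forall h : R, 0 < h -> ~ L2cauchy gamma (fun N => K N h) &
      forall h : nat -> R, (forall N, 0 < h N) ->
        L2norm gamma (K N (h N) \- K N.-1 (h N)) @[N --> \oo] --> 0%E ->
        h N * (a * b) ^+ N @[N --> \oo] --> 0].
Proof.
have b0 : 0 < b by exact: lt_trans Hb.
have [d d0 zd] := zeta_lower_bound _ _ _ Hb Hphi Hdphi Hdphi_gt0.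
have k0 : 0 < `|kappa| by rewrite normr_gt0.
have ab0 n : 0 < (a * b) ^+ n by rewrite exprn_gt0// mulr_gt0.
move=> K.
have normK h N : 0 < h -> (1 <= N)%N -> L2norm gamma (K N h \- K N.-1 h) =
    (`|kappa| * h / 2 * (a * b) ^+ N * zeta b dphi N)%:E.
  by case: N => // N h0 _; exact: L2norm_kick_increment Hphi Hdphi Ha0 b0 h0.
split.
- by move=> h h0 N N1; exact: normK.
(* Consecutive maps never come closer than [`|kappa| * h / 2 * d], as
   [(a * b) ^+ N >= 1]. *)
- move=> h h0 /(_ (`|kappa| * h / 2 * d)) [].
    by rewrite !mulr_gt0// invr_gt0.
  move=> M /(_ M.+1 M (leqnSn _) (leqnn _)).
  rewrite (normK _ _ h0 (ltn0Sn _)) lte_fin ltNge => /negP; apply.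
  rewrite -[leRHS]mulrA ler_wpM2l ?divr_ge0 ?mulr_ge0 ?(ltW h0)//.
  by rewrite (le_trans (zd M.+1))// ler_peMl ?sqrtr_ge0// exprn_ege1// ltW.
move=> h h0 /fine_cvg/= hK.
(* [e * (h N * (a * b) ^+ N)] is at most the norm of the increment. *)
set e := `|kappa| / 2 * d; have e0 : 0 < e by rewrite !mulr_gt0// invr_gt0.
have : e^-1 * fine (L2norm gamma (K N (h N) \- K N.-1 (h N))) @[N --> \oo] --> 0.
  by rewrite -[X in _ --> X](mulr0 e^-1); apply: cvgMr.
move=> cvK; apply: (squeeze_cvgr _ (cvg_cst _) cvK).
near=> N.
have N1 : (1 <= N)%N by near: N; exact: nbhs_infty_ge.
have hab : 0 <= h N * (a * b) ^+ N by rewrite mulr_ge0// ltW.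
rewrite (normK _ _ (h0 N) N1) /= hab/=.
rewrite ler_pdivlMl// /e.
rewrite (_ : `|kappa| * h N / 2 * (a * b) ^+ N * zeta b dphi N =
  `|kappa| / 2 * zeta b dphi N * (h N * (a * b) ^+ N)); last by field.
by rewrite ler_wpM2r// ler_wpM2l// divr_ge0.
Unshelve. all: by end_near. Qed.
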